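(* There is an absolute constant $\Delta_0$ such that the following holds. Let $G$ be a graph of maximum degree $\Delta\ge\Delta_0$ and minimum degree $\delta\ge 12\ln(2\Delta)$. Then $$\chi_o(G)\le \chi(G)+\left\lceil 4(\ln\Delta+\ln\ln\Delta+3)\right\rceil+\frac{20\,\Delta\ln(2\Delta)}{\delta};$$ in particular $\chi_o(G)\le \chi(G)+O\!\left(\frac{\Delta\ln\Delta}{\delta}\right)$ as $\Delta\to\infty$.
   Context: All graphs are finite, undirected and simple. $\chi(G)$ is the chromatic number. An odd colouring of a graph $G$ is a proper vertex-colouring $\sigma$ of $G$ such that for every non-isolated vertex $v$ there is a colour that appears an odd number of times on the (open) neighbourhood $N_G(v)$. The odd chromatic number $\chi_o(G)$ is the minimum integer $k$ such that $G$ has an odd colouring $\sigma\colon V(G)\to\{1,\dots,k\}$. *)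

(* Defs.v *)
From HB Require Import structures.
From mathcomp Require Import all_boot all_order all_algebra.
Set Implicit Arguments.
Unset Strict Implicit.
Unset Printing Implicit Defensive.

Record sgraph := SGraph {
  svertex :> finType;
  sedge : rel svertex;
  sedge_sym : symmetric sedge;
  sedge_irr : irreflexive sedge }.

Section Graph.
Variable G : sgraph.

Definition neighbours (v : G) : {set G} := [set u | sedge v u].

Definition degree (v : G) : nat := #|neighbours v|.

Definition max_degree : nat := \max_(v : G) degree v.

(* The initial value #|G| exceeds every degree, so it never contributes to the
   minimum unless G has no vertex, in which case min_degree is 0. *)
Definition min_degree : nat := \big[minn/#|G|]_(v : G) degree v.

Definition isolated (v : G) : bool := neighbours v == set0.

Section Colouring.
Variables (k : nat) (s : {ffun G -> 'I_k}).

Definition proper_colouring : bool :=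
  [forall u, forall v, sedge u v ==> (s u != s v)].

Definition odd_colouring : bool :=
  proper_colouring &&
  [forall v, ~~ isolated v ==>
     [exists c : 'I_k, odd #|[set u in neighbours v | s u == c]|]].

End Colouring.

Definition colourable (k : nat) : bool :=
  [exists s : {ffun G -> 'I_k}, proper_colouring s].

Definition odd_colourable (k : nat) : bool :=
  [exists s : {ffun G -> 'I_k}, odd_colouring s].

Let rank_colouring : {ffun G -> 'I_#|G|} := [ffun v => enum_rank v].

Let rank_colouring_odd : odd_colouring rank_colouring.
Proof.
apply/andP; split.
  apply/forallP=> u; apply/forallP=> v; apply/implyP=> uv.
  rewrite !ffunE (inj_eq enum_rank_inj).
  by apply: contraTneq uv => ->; rewrite sedge_irr.
apply/forallP=> v; apply/implyP=> /set0Pn[u uN].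
apply/existsP; exists (enum_rank u).
rewrite (_ : [set _ in _ | _] = [set u]) ?cards1 //.
apply/setP=> w; rewrite !inE ffunE (inj_eq enum_rank_inj).
by case: eqP => [->|]; rewrite ?andbF //; rewrite inE in uN; rewrite uN.
Qed.

Lemma odd_colourable_ex : exists k, odd_colourable k.
Proof.
by exists #|G|; apply/existsP; exists rank_colouring; exact: rank_colouring_odd.
Qed.

Lemma colourable_ex : exists k, colourable k.
Proof.
exists #|G|; apply/existsP; exists rank_colouring.
by case/andP: rank_colouring_odd.
Qed.

Definition chromatic_number : nat := ex_minn colourable_ex.

Definition odd_chromatic_number : nat := ex_minn odd_colourable_ex.

End Graph.

(* Main.v *)
Require Import Defs.
From HB Require Import structures.
From mathcomp Require Import all_classical all_reals all_analysis.
From mathcomp Require Import all_boot all_order all_algebra.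
From mathcomp Require Import ring lra.
Set Implicit Arguments.
Unset Strict Implicit.
Unset Printing Implicit Defensive.
Import Order.TTheory GRing.Theory Num.Theory.
Local Open Scope ring_scope.

(** Write L for ln (2 Delta) and let K be the least integer above
    20 Delta L / delta.  Give every vertex a random label among 5 Delta, of
    which K are new colours.  A vertex labelled by a new colour takes it; every
    other vertex keeps its colour in a fixed proper colouring with
    chi(G) colours.  The result is an odd colouring with chi(G) + K colours
    unless one of two kinds of flaw occurs:
    - both ends of an edge receive the same new colour;
    - every new colour occurs an even number of times around some vertex.
    All the stated terms are paid for by K <= 20 Delta L / delta + 1: the
    rounded term of the first bound only has to be at least 1.

    A labelling without flaws is found by counting, in the style of Rosenfeld.
    Call a labelling flawless on X if no flaw lies inside X.  By induction on
    X, adding one vertex to X keeps at least a proportion b of the labellings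
    flawless on X.  Indeed, a labelling lost when u is added has a flaw i whose
    scope contains u.  Forget its labels on a set A_i: it is then a labelling
    flawless on X minus A_i, and by induction there are at most b^-|A_i - u|
    times as many of these as of labellings flawless on X.  Relabelling A_i at
    random brings the flaw back with probability at most q_i.  So the induction
    closes as soon as the sum of q_i b^-|A_i - u| over the flaws at u is at most
    1 - b ([flawless_exists]).

    Let p = K / (5 Delta) be the density of new colours.  An edge is flawed
    with probability p / (5 Delta), hence the edges at u contribute about p / 5.
    For a vertex v, only delta of its neighbours are relabelled.  Averaging
    characters of the parity vector bounds the probability that all the
    multiplicities become even by ((1 + exp (- 2 delta / (5 Delta))) / 2)^K
    ([all_even_rare]), which is about exp (- 0.8 p delta).  With b = 1 - p / 4,
    the factor b^-delta costs about exp (0.25 p delta) only.  Since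
    p delta >= 4 L, the product is at most exp (- 2 L) = 1 / (4 Delta^2), and
    the Delta vertices next to u contribute at most 1 / (4 Delta), which is
    smaller than p / 20.  The total is thus below p / 4 = 1 - b. *)

(** * Resampling some coordinates of a finite function *)

Section Resampling.
Variables (R : realFieldType) (T C : finType).
Implicit Types (A : {set T}) (f g : {ffun T -> C}).

Definition agree_off A f g : bool := [forall x, (x \notin A) ==> (f x == g x)].

Lemma agree_offC A f g : agree_off A f g = agree_off A g f.
Proof. by apply: eq_forallb => x; rewrite eq_sym. Qed.

(** Independence: the coordinates in [A] range freely and the others are
    frozen, so that the sum of a product factors. *)
Lemma sum_agree_off (V : comPzRingType) A f (F : T -> C -> V) :
  \sum_(g | agree_off A f g) \prod_x F x (g x) =
  (\prod_(x in A) \sum_c F x c) * \prod_(x in ~: A) F x (f x).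
Proof.
have -> : \sum_(g | agree_off A f g) \prod_x F x (g x) =
    \sum_(g : {ffun T -> C}) \prod_x (((x \in A) || (f x == g x))%:R * F x (g x)).
  rewrite big_mkcond; apply: eq_bigr => g _; case: ifP => [/forallP fg|].
    apply: eq_bigr => x _; have := fg x.
    by case: (x \in A) => /= [_|->]; rewrite mul1r.
  move=> /negbT; rewrite negb_forall => /existsP[x].
  rewrite negb_imply => /andP[/negPf xA /negPf xfg].
  by rewrite (bigD1 x) //= xA xfg !mul0r.
rewrite -(bigA_distr_bigA (fun x c => ((x \in A) || (f x == c))%:R * F x c)) /=.
rewrite (bigID (mem A)) /=; congr (_ * _).
  by apply: eq_bigr => x ->; apply: eq_bigr => c _; rewrite mul1r.
apply: eq_big => [x|x /negPf xA]; first by rewrite inE.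
rewrite (bigD1 (f x)) //= xA eqxx mul1r big1 ?addr0 // => c.
by rewrite eq_sym => /negPf->; rewrite mul0r.
Qed.

Lemma card_agree_off A f : #|[set g | agree_off A f g]|%:R = #|C|%:R ^+ #|A| :> R.
Proof.
rewrite -sum1_card natr_sum.
have := @sum_agree_off R A f (fun _ _ => 1).
rewrite [X in _ * X]big1 // mulr1 prodr_const.
have -> : \sum_(c : C) 1 = #|C|%:R :> R by rewrite sumr_const.
move=> <-.
by apply: eq_big => [g|g _]; [rewrite inE | rewrite big1].
Qed.

(** If [F] does not look at the coordinates in [A], and resampling them lands in
    [B] with probability at most [q], then a uniform element of [F] lies in [B]
    with probability at most [q]: count in two ways the pairs of an element of
    [F] and an element of [B] that agree off [A]. *)
Lemma resampling A (F B : {set {ffun T -> C}}) (q : R) :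
  (0 < #|C|)%N ->
  (forall f g, agree_off A f g -> f \in F -> g \in F) ->
  (forall f, #|[set g in B | agree_off A f g]|%:R <= q * #|C|%:R ^+ #|A|) ->
  #|F :&: B|%:R <= q * #|F|%:R.
Proof.
move=> C0 Fstable Bq.
have M0 : 0 < #|C|%:R ^+ #|A| :> R by rewrite exprn_gt0 // ltr0n.
rewrite -(ler_pM2r M0).
have -> : #|F :&: B|%:R * #|C|%:R ^+ #|A| =
    \sum_(f in F) #|[set g in B | agree_off A f g]|%:R :> R.
  transitivity (\sum_(g in F :&: B) \sum_(f in F | agree_off A f g) 1 : R).
    rewrite -sumr_const mulr_suml; apply: eq_bigr => g /setIP[gF _].
    rewrite mul1r -(card_agree_off A g) -sum1_card natr_sum.
    apply: eq_bigl => f; rewrite inE agree_offC.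
    by case fg: (agree_off A f g); rewrite ?andbF // andbT
      (Fstable g f) // agree_offC.
  under [RHS]eq_bigr => f _ do rewrite -sum1_card natr_sum.
  rewrite (exchange_big_dep (mem F)) /=; last by move=> f g _ /andP[].
  apply: eq_bigr => f fF; apply: eq_bigl => g; rewrite !inE.
  case fg: (agree_off A f g); rewrite ?andbF // !andbT.
  by rewrite (Fstable f g) // fF andbT.
rewrite mulrAC mulr_natr -sumr_const.
by apply: ler_sum => f _; apply: Bq.
Qed.

(** * A counting local lemma *)

Section Flaws.
(* The set [A i] on which the flaw [i] is resampled may be smaller than its
   scope [S i]: a small [A i] limits the loss [b ^- #|A i :\ u|]. *)
Variables (I : finType) (S A : I -> {set T}) (bad : I -> pred {ffun T -> C}).
Variables (q : I -> R) (b : R).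
Hypothesis C0 : (0 < #|C|)%N.
Hypothesis badS : forall i f g, {in S i, f =1 g} -> bad i f = bad i g.
Hypothesis bad0 : forall i f, bad i f -> S i != set0.
Hypothesis badq : forall i f,
  #|[set g | bad i g & agree_off (A i) f g]|%:R <= q i * #|C|%:R ^+ #|A i|.
Hypothesis b0 : 0 < b.
Hypothesis sumq : forall u,
  \sum_(i | u \in S i) q i * b ^- #|A i :\ u| <= 1 - b.

(** Only the flaws whose whole scope lies in [X] are excluded, so that membership
    depends on the coordinates in [X] alone. *)
Definition flawless (X : {set T}) : {set {ffun T -> C}} :=
  [set f | [forall i, (S i \subset X) ==> ~~ bad i f]].

Let q_ge0 i : 0 <= q i.
Proof.
have /card_gt0P[c _] := C0.
rewrite -(@pmulr_lge0 _ (#|C|%:R ^+ #|A i|)); last by rewrite exprn_gt0 // ltr0n.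
exact: le_trans (ler0n _ _) (badq i [ffun=> c]).
Qed.

Let b1 (u : T) : b <= 1.
Proof.
rewrite -subr_ge0; apply: le_trans (sumq u); apply: sumr_ge0 => i _.
by rewrite mulr_ge0 // invr_ge0 exprn_ge0 // ltW.
Qed.

Let flawless_stable (X Y : {set T}) f g : [disjoint X & Y] ->
  agree_off Y f g -> f \in flawless X -> g \in flawless X.
Proof.
move=> dXY /forallP fg; rewrite !inE => /forallP fX; apply/forallP=> i.
apply/implyP=> SX; have := fX i; rewrite SX /=.
rewrite (@badS i g f) // => x xS; apply/esym/eqP; move/implyP: (fg x); apply.
by rewrite (disjointFr dXY) // (subsetP SX).
Qed.

(** The strong induction on [X] bounds the number of labellings lost to each
    flaw at [u]: such a labelling is flawless on [X :\: A i], which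
    [resampling] relates to the probability of the flaw, and the induction
    hypothesis charges a factor [b] for each vertex put back to recover [X]. *)
Lemma flawless_step (X : {set T}) u : u \notin X ->
  b * #|flawless X|%:R <= #|flawless (u |: X)|%:R.
Proof.
have [n] := ubnP #|X|; elim: n X u => // n IH X u /ltnSE leXn uX.
(* Iterated induction hypothesis: vertices can be added one at a time. *)
have grow (Y Z : {set T}) : (#|Y :|: Z| <= n)%N ->
    b ^+ #|Z :\: Y| * #|flawless Y|%:R <= #|flawless (Y :|: Z)|%:R.
  move: {2}#|_| (erefl #|Z :\: Y|) => m; elim: m Y => [|m IHm] Y Em leYZ.
    rewrite Em expr0 mul1r; move/eqP: Em; rewrite cards_eq0 setD_eq0.
    by move/setUidPl->.
  have /set0Pn[z] : Z :\: Y != set0 by rewrite -cards_eq0 Em.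
  rewrite inE => /andP[zY zZ].
  have EYZ : (z |: Y) :|: Z = Y :|: Z.
    by rewrite [z |: Y]setUC -setUA [z |: Z](setUidPr _) ?sub1set.
  have Em' : #|Z :\: (z |: Y)| = m.
    apply: succn_inj; rewrite -Em [RHS](cardsD1 z) inE zY zZ; congr (_.+1).
    by apply: eq_card => x; rewrite !inE negb_or andbA.
  have := IHm _ Em'; rewrite EYZ Em' Em => /(_ leYZ); apply: le_trans.
  rewrite exprSr -mulrA; apply: ler_wpM2l; first by rewrite exprn_ge0 // ltW.
  apply: (IH) => //.
  apply: leq_trans leYZ; apply: proper_card; apply/properP; split.
    exact: subsetUl.
  by exists z => //; rewrite inE zZ orbT.
pose lost i := flawless (X :\: A i) :&: [set f | bad i f].
have lost_le i : u \in S i ->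
    #|lost i|%:R <= q i * b ^- #|A i :\ u| * #|flawless X|%:R.
  move=> uS; apply: (@le_trans _ _ (q i * #|flawless (X :\: A i)|%:R)).
    apply: (@resampling (A i)) => // [f g|f].
      by apply: flawless_stable; rewrite -setI_eq0 setIDAC -setIDA setDv setI0.
    by apply: le_trans (badq i f); rewrite ler_nat subset_leq_card //;
      apply/subsetP=> g; rewrite !inE.
  rewrite -mulrA ler_wpM2l // ler_pdivlMl ?exprn_gt0 //.
  have EX : (X :\: A i) :|: (X :&: A i) = X by rewrite setUC setID.
  have := grow (X :\: A i) (X :&: A i); rewrite EX => /(_ leXn); apply: le_trans.
  rewrite ler_wpM2r // ler_wiXn2l ?(ltW b0) ?(b1 u) // subset_leq_card //.
  apply/subsetP=> x; rewrite !inE => /andP[_ /andP[xX ->]].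
  by rewrite andbT; apply: contraNneq uX => <-.
have sub : flawless X :\: flawless (u |: X) \subset \bigcup_(i | u \in S i) lost i.
  apply/subsetP=> f; rewrite !inE negb_forall => /andP[/existsP[i]].
  rewrite negb_imply negbK => /andP[SX badf] /forallP fX.
  apply/bigcupP; exists i.
    apply: contraLR badf => uS; have := fX i; rewrite (_ : S i \subset X) //.
    apply/subsetP=> x xS; have := subsetP SX x xS; rewrite !inE.
    by case/predU1P=> // xu; rewrite -xu xS in uS.
  rewrite !inE badf andbT; apply/forallP=> j; apply/implyP=> Sj.
  by apply: (implyP (fX j)); apply: subset_trans Sj (subsetDl _ _).
have mono : flawless (u |: X) \subset flawless X.
  apply/subsetP=> f; rewrite !inE => /forallP fX; apply/forallP=> i.
  apply/implyP=> Si; apply: (implyP (fX i)); apply: subset_trans Si (subsetUr _ _).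
have : #|flawless X :\: flawless (u |: X)|%:R <= (1 - b) * #|flawless X|%:R :> R.
  apply: (@le_trans _ _ (\sum_(i | u \in S i) #|lost i|%:R)).
    rewrite -natr_sum ler_nat; apply: leq_trans (subset_leq_card sub) _.
    elim/big_rec2: _ => [|i m Y uS IHY]; first by rewrite cards0.
    by rewrite (leq_trans (leq_card_setU _ _)) // leq_add2l.
  apply: (@le_trans _ _
    (\sum_(i | u \in S i) q i * b ^- #|A i :\ u| * #|flawless X|%:R)).
    by apply: ler_sum => i; apply: lost_le.
  by rewrite -mulr_suml ler_wpM2r.
rewrite cardsD (setIidPr mono) natrB ?subset_leq_card // mulrBl mul1r.
by rewrite lerD2l lerN2.
Qed.

(** Each step keeps a positive proportion of labellings, and all of them are
    flawless on the empty set. *)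
Lemma flawless_exists : exists f, forall i, ~~ bad i f.
Proof.
have /card_gt0P[c _] := C0.
have pos (X : {set T}) : (0 < #|flawless X|)%N.
  have [n] := ubnP #|X|; elim: n X => // n IH X /ltnSE leXn.
  have [->|[u uX]] := set_0Vmem X.
    apply/card_gt0P; exists [ffun=> c]; rewrite inE; apply/forallP=> i.
    by apply/implyP; rewrite subset0 => /eqP S0; apply/negP=> /bad0; rewrite S0 eqxx.
  rewrite -(setD1K uX) -(ltr0n R); apply: lt_le_trans (flawless_step _).
    rewrite mulr_gt0 // ltr0n IH //; apply: leq_trans leXn.
    by rewrite (cardsD1 u X) uX.
  by rewrite !inE eqxx.
have /card_gt0P[f] := pos setT; rewrite inE => /forallP fT.
by exists f => i; have := fT i; rewrite subsetT.
Qed.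

End Flaws.
End Resampling.

(** * Two rare events *)

Section Labels.
Variables (R : realType) (T C : finType).
Implicit Types (A N : {set T}) (D J : {set C}) (f g : {ffun T -> C}).

Definition all_even D N g : bool :=
  [forall x in D, ~~ odd #|[set u in N | g u == x]|].

Definition constant_on D A g : bool :=
  [exists x in D, forall u in A, g u == x].

(** The character of the parity vector that is attached to the set of colours
    [J] is the product of these signs over all vertices. *)
Definition flip J N u (c : C) : R := if (u \in N) && (c \in J) then -1 else 1.

(** At [z = 1] this is the Fourier coefficient at [J] of the event that all the
    colours of [D] have even multiplicity: [2 ^- #|D|] if [J \subset D], and 0
    otherwise.  The variable [z] tracks the size of [J], so that the same
    expansion can be summed back after each character has been averaged. *)
Definition weight D (z : R) J : R :=
  \prod_x (if x \in J then (x \in D)%:R / 2 * z else if x \in D then 2^-1 else 1).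

Lemma sum_weight D z : \sum_(J in {set C}) weight D z J = ((1 + z) / 2) ^+ #|D|.
Proof.
rewrite /weight -(bigA_distr 1%R +%R) /= -prodr_const [RHS]big_mkcond /=.
apply: eq_bigr => x _; case: (x \in D); last by rewrite !mul0r add0r.
by rewrite mulr1n; field.
Qed.

(** Expand the product over the colours of [D] of [(1 + s) / 2], where [s] is the
    sign given by the parity of the multiplicity of the colour. *)
Lemma all_even_weight D N g :
  (all_even D N g)%:R = \sum_(J in {set C}) weight D 1 J * \prod_u flip J N u (g u).
Proof.
pose s x : R := (-1) ^+ #|[set u in N | g u == x]|.
transitivity (\prod_x ((x \in D)%:R / 2 * s x + (if x \in D then 2^-1 else 1))).
  have half x : x \in D ->
      (x \in D)%:R / 2 * s x + (if x \in D then 2^-1 else 1) =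
      (~~ odd #|[set u in N | g u == x]|)%:R.
    move=> ->; rewrite /s -signr_odd; case: odd; rewrite ?expr1 ?expr0 /=; by field.
  have [|] := boolP (all_even D N g); rewrite /all_even.
    move=> /forall_inP ev; rewrite big1 // => x _; case: (boolP (x \in D)) => xD.
      by have := half x xD; rewrite xD => ->; rewrite (ev x xD).
    by rewrite !mul0r add0r.
  rewrite negb_forall_in => /exists_inP[x xD /negPn ox].
  by rewrite (bigD1 x) //= half // ox mul0r.
rewrite (bigA_distr 1%R +%R) /=; apply: eq_bigr => J _.
transitivity (weight D 1 J * \prod_(x in J) s x).
  rewrite /weight [X in _ * X]big_mkcond -big_split /=; apply: eq_bigr => x _.
  by case: ifP; rewrite ?mulr1.
congr (_ * _).
transitivity (\prod_(x in J) \prod_(u in N) (if g u == x then -1 else 1 : R)).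
  apply: eq_bigr => x _; rewrite -big_mkcondr /= /s -prodr_const.
  by apply: eq_bigl => u; rewrite inE.
rewrite exchange_big /= [LHS]big_mkcond; apply: eq_bigr => u _.
rewrite /flip; case: (u \in N) => //=; case: (boolP (g u \in J)) => guJ.
  rewrite (bigD1 (g u)) //= eqxx big1 ?mulr1 // => x /andP[_].
  by rewrite eq_sym => /negPf->.
by rewrite big1 // => x xJ; case: eqP => // gx; rewrite gx xJ in guJ.
Qed.

(** The frozen coordinates contribute a sign; each of the others contributes
    the number of labels outside [J] minus the number of labels in [J]. *)
Lemma sum_flip A N f J : A \subset N ->
  `|\sum_(g | agree_off A f g) \prod_u flip J N u (g u)| =
  `|#|C|%:R - 2 * #|J|%:R| ^+ #|A|.
Proof.
move=> /subsetP AN; rewrite sum_agree_off normrM !normr_prod.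
rewrite [X in _ * X]big1 ?mulr1; last first.
  by move=> u _; rewrite /flip; case: ifP; rewrite ?normrN normr1.
rewrite -prodr_const; apply: eq_bigr => u /AN uN; congr `|_|.
rewrite /flip uN /= (bigID (mem J)) /=.
rewrite (eq_bigr (fun=> -1)); last by move=> c ->.
rewrite sumr_const [X in _ + X](eq_bigr (fun=> 1)); last by move=> c /negPf->.
rewrite (eq_bigl [in ~: J]); last by move=> c; rewrite /= inE.
rewrite sumr_const [#|~: J|]cardsCs setCK natrB ?max_card // mulNrn; ring.
Qed.

(** The character of [J] averages to at most [(1 - 2 * #|J| / #|C|) ^+ #|A|],
    hence to at most [z ^+ #|J|] with [z = expR (- 2 * #|A| / #|C|)]; the
    condition [2 * #|D| <= #|C|] makes the base nonnegative.  The weighted sum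
    over [J] is then [((1 + z) / 2) ^+ #|D|]. *)
Lemma all_even_rare D A N f : A \subset N -> (2 * #|D| <= #|C|)%N ->
  #|[set g | all_even D N g & agree_off A f g]|%:R <=
    ((1 + expR (- (2 * #|A|%:R / #|C|%:R))) / 2) ^+ #|D| * #|C|%:R ^+ #|A| :> R.
Proof.
move=> AN leDC; set z := expR _.
rewrite -sum_weight mulr_suml -sum1_card natr_sum.
have -> : \sum_(g in [set g | all_even D N g & agree_off A f g]) 1%:R =
    \sum_(g | agree_off A f g) (all_even D N g)%:R :> R.
  rewrite [LHS]big_mkcond [RHS]big_mkcond /=; apply: eq_bigr => g _.
  by rewrite inE; case: all_even; case: agree_off.
under eq_bigr => g _ do rewrite all_even_weight.
rewrite exchange_big /=; apply: ler_sum => J _; rewrite -mulr_sumr.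
have [JD|nJD] := boolP (J \subset D); last first.
  have [x xJ xD] := subsetPn nJD.
  by rewrite /weight (bigD1 x) //= [X in _ <= X * _](bigD1 x) //=
    xJ (negPf xD) !mul0r.
have w0 : 0 <= weight D 1 J.
  by apply: prodr_ge0 => x _; case: ifP => _; [|case: ifP => _];
    rewrite ?mulr1 ?divr_ge0 ?invr_ge0 ?ler0n.
have -> : weight D z J = weight D 1 J * z ^+ #|J|.
  rewrite /weight -prodr_const [X in _ * X]big_mkcond -big_split /=.
  by apply: eq_bigr => x _; case: ifP; rewrite ?mulr1.
rewrite -mulrA ler_wpM2l //; apply: le_trans (ler_norm _) _.
rewrite sum_flip //.
have leJC : (2 * #|J| <= #|C|)%N.
  by apply: leq_trans leDC; rewrite leq_mul2l subset_leq_card.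
rewrite ger0_norm; last by rewrite subr_ge0 -natrM ler_nat.
have [C0|C0] := posnP #|C|.
  have -> : #|J| = 0%N by apply/eqP; move: leJC; rewrite C0 leqn0 muln_eq0.
  by rewrite C0 expr0 mul1r mulr0 subr0.
have C0R : 0 < #|C|%:R :> R by rewrite ltr0n.
have -> : z ^+ #|J| * #|C|%:R ^+ #|A| =
    (#|C|%:R * expR (- (2 * #|J|%:R / #|C|%:R))) ^+ #|A|.
  rewrite /z exprMn mulrC -!expRM_natl; congr (_ * expR _); ring.
apply: lerXn2r; rewrite ?nnegrE ?mulr_ge0 ?expR_ge0 ?ler0n //.
  by rewrite subr_ge0 -natrM ler_nat.
apply: (@le_trans _ _ (#|C|%:R * (1 + - (2 * #|J|%:R / #|C|%:R)))).
  by rewrite le_eqVlt; apply/orP; left; apply/eqP; field; rewrite gt_eqF.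
by rewrite ler_wpM2l ?ler0n // expR_ge1Dx.
Qed.

(** The labelling is determined by the common value on [A], which is in [D]. *)
Lemma constant_on_rare D A f : A != set0 ->
  (#|[set g | constant_on D A g & agree_off A f g]| <= #|D|)%N.
Proof.
move=> /set0Pn[u uA].
rewrite -(@card_in_imset _ _ (fun g : {ffun T -> C} => g u)).
  apply: subset_leq_card; apply/subsetP=> c /imsetP[g]; rewrite inE.
  by case/andP=> /exists_inP[x xD /forall_inP/(_ u uA)/eqP gu] _ ->; rewrite gu.
move=> g h; rewrite !inE.
case/andP=> /exists_inP[x xD /forall_inP gA] /forallP fg.
case/andP=> /exists_inP[y yD /forall_inP hA] /forallP fh ghu.
apply/ffunP=> v; have [vA|vA] := boolP (v \in A).
  rewrite (eqP (gA v vA)) (eqP (hA v vA)).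
  by rewrite -(eqP (gA u uA)) ghu (eqP (hA u uA)).
by have := fg v; have := fh v; rewrite vA /= => /eqP<- /eqP<-.
Qed.

End Labels.

Lemma subset_of_card (T : finType) (N : {set T}) n : (n <= #|N|)%N ->
  exists A : {set T}, A \subset N /\ #|A| = n.
Proof.
case/card_geqP=> s [us <- sN]; exists [set x in s]; split.
  by apply/subsetP=> x; rewrite inE => /sN.
by rewrite cardsE; apply/card_uniqP.
Qed.

(** * Recolouring a graph *)

Section Graph.
Variables (R : realType) (G : sgraph).

Lemma degree_le_max (v : G) : (degree v <= max_degree G)%N.
Proof. exact: (leq_bigmax v). Qed.

Lemma min_degree_le (v : G) : (min_degree G <= degree v)%N.
Proof.
rewrite /min_degree; have := mem_index_enum v.
elim: (index_enum _) => // u s IHs; rewrite inE big_cons.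
case/predU1P=> [<-|/IHs]; first exact: geq_minl.
by apply: leq_trans; apply: geq_minr.
Qed.

Definition is_edge (e : {set G}) : bool :=
  [exists u, exists v, sedge u v && (e == [set u; v])].

Lemma edges_at (u : G) (e : {set G}) : is_edge e -> u \in e ->
  #|e :\ u| = 1%N /\ e \in [set [set u; w] | w in neighbours u].
Proof.
have at_end (x y : G) : sedge x y ->
    #|[set x; y] :\ x| = 1%N /\
    [set x; y] \in [set [set x; w] | w in neighbours x].
  move=> xy; split; last by apply: imset_f; rewrite inE.
  apply/eqP; apply/cards1P; exists y; apply/setP=> z; rewrite !inE.
  by case: eqVneq => // ->; case: eqVneq => // exy; rewrite exy sedge_irr in xy.
case/existsP=> x /existsP[y /andP[xy /eqP->]]; rewrite !inE.
case/pred2P=> ->; first exact: at_end.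
by rewrite setUC; apply: at_end; rewrite sedge_sym.
Qed.

Section Palette.
Variables (k K M : nat).
Implicit Types (f : {ffun G -> 'I_K + 'I_M}).

(** The labels in ['I_K] are the new colours, and a label in ['I_M] tells the
    vertex to keep its old colour; [K + M] is the number of labels. *)
Definition new_colours : {set 'I_K + 'I_M} := [set inl x | x in 'I_K].

Lemma card_new_colours : #|new_colours| = K.
Proof. by rewrite card_imset ?card_ord // => x y []. Qed.

(** A new colour that is odd around a vertex stays odd in the combined
    colouring, because the old colours are disjoint from the new ones. *)
Lemma odd_colourable_of_flawless f : colourable G k ->
  (forall u v : G, sedge u v -> ~~ constant_on new_colours [set u; v] f) ->
  (forall v : G, ~~ all_even new_colours (neighbours v) f) ->
  odd_colourable G (k + K).
Proof.
move=> /existsP[c /forallP c_proper] f_proper f_odd.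
pose s : {ffun G -> 'I_(k + K)} :=
  [ffun v => unsplit (if f v is inl x then inr x else inl (c v))].
have sE v (x : 'I_K) : (s v == unsplit (inr x)) = (f v == inl x).
  rewrite ffunE (can_eq (@unsplitK _ _)).
  by case: (f v) => [y|y]; rewrite ?(inj_eq inl_inj) ?(inj_eq inr_inj).
apply/existsP; exists s; apply/andP; split.
  apply/forallP=> u; apply/forallP=> v; apply/implyP=> uv; apply/negP=> /eqP suv.
  case Efu: (f u) => [x|x].
    have /negP := f_proper u v uv; apply; apply/exists_inP; exists (inl x).
      exact: imset_f.
    apply/forall_inP=> w; rewrite !inE => /pred2P[]->; first by rewrite Efu.
    by rewrite -sE -suv sE Efu.
  case Efv: (f v) => [y|y].
    by have := sE u y; rewrite suv sE Efv Efu eqxx.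
  move/eqP: suv; rewrite !ffunE Efu Efv (can_eq (@unsplitK _ _)).
  rewrite (inj_eq inl_inj); apply/negP.
  by have /forallP/(_ v)/implyP := c_proper u; apply.
apply/forallP=> v; apply/implyP=> _.
have := f_odd v; rewrite negb_forall_in => /exists_inP[_ /imsetP[x _ ->]].
rewrite negbK => ox; apply/existsP; exists (unsplit (inr x)).
by rewrite (eq_card (B := [set u in neighbours v | f u == inl x])) // => u;
  rewrite !inE sE.
Qed.

(** The two terms of the budget are the contributions of the edges at a vertex
    and of its neighbours.  Resampling exactly [delta] neighbours of each
    vertex keeps the loss [b ^- delta] small when the degrees are far larger
    than [delta]. *)
Lemma random_new_colours (Delta delta : nat) (b : R) :
  colourable G k -> (0 < delta)%N -> (0 < K <= M)%N -> 0 < b -> b <= 1 ->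
  (forall v : G, delta <= degree v <= Delta)%N ->
  Delta%:R * (K%:R / (K + M)%:R ^+ 2 / b) +
  Delta%:R * (((1 + expR (- (2 * delta%:R / (K + M)%:R))) / 2) ^+ K
              / b ^+ delta) <= 1 - b ->
  odd_colourable G (k + K).
Proof.
move=> Gk delta0 /andP[K0 KM] b0 b1 degG budget.
set r : R := K%:R / (K + M)%:R ^+ 2 in budget.
set s : R := _ ^+ K in budget.
have [A AP] : exists A : G -> {set G},
    forall v, A v \subset neighbours v /\ #|A v| = delta.
  apply: (@fin_all_exists _ (fun=> {set G})
    (fun v A => A \subset neighbours v /\ #|A| = delta)) => v.
  by apply: subset_of_card; have /andP[] := degG v.
have AN v : A v \subset neighbours v by have [] := AP v.
have cA v : #|A v| = delta by have [] := AP v.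
have cC : #|{: 'I_K + 'I_M}| = (K + M)%N by rewrite card_sum !card_ord.
have N0 : 0 < (K + M)%:R :> R by rewrite ltr0n addn_gt0 K0.
have r0 : 0 <= r by rewrite divr_ge0 ?exprn_ge0 ?ler0n.
have s0 : 0 <= s by rewrite exprn_ge0 // divr_ge0 ?addr_ge0 ?expR_ge0.
(* The flaws are indexed by sets of vertices, of which only the edges count,
   and by vertices. *)
pose S (i : {set G} + G) := match i with inl e => e | inr v => neighbours v end.
pose B (i : {set G} + G) := match i with inl e => e | inr v => A v end.
pose bad (i : {set G} + G) (f : {ffun G -> 'I_K + 'I_M}) := match i with
  | inl e => is_edge e && constant_on new_colours e f
  | inr v => all_even new_colours (neighbours v) f end.
pose q (i : {set G} + G) := match i with
  | inl e => if is_edge e then r else 0 | inr v => s end.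
have [f f_ok] : exists f, forall i, ~~ bad i f.
  apply: (@flawless_exists _ _ _ _ S B bad q b) => //.
  - by rewrite cC addn_gt0 K0.
  - move=> [e|v] f g fg /=.
      congr (_ && _); apply: eq_existsb => x; congr (_ && _).
      by apply: eq_forallb => u; case: (boolP (u \in e)) => //= ue; rewrite fg.
    apply: eq_forallb => x; congr (_ ==> ~~ odd _).
    apply: eq_card => u; rewrite !inE; case: (boolP (sedge v u)) => //= vu.
    by rewrite fg //= inE.
  - move=> [e|v] f /=.
      case/andP=> /existsP[x /existsP[y /andP[_ /eqP->]]] _.
      by apply/set0Pn; exists x; rewrite !inE eqxx.
    by move=> _; rewrite -card_gt0 (leq_trans delta0) //; case/andP: (degG v).
  - move=> [e|v] f /=; rewrite cC; last first.
      have := all_even_rare R f (D := new_colours) (AN v).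
      rewrite cC card_new_colours cA; apply.
      by rewrite mul2n -addnn leq_add2l.
    case: ifPn => [ee|nee]; last first.
      by rewrite mul0r (_ : [set _ | _] = set0) ?cards0 //; apply/setP=> g;
        rewrite !inE.
    have [x xe] : exists x, x \in e.
      case/existsP: (ee) => x /existsP[y /andP[_ /eqP->]].
      by exists x; rewrite !inE eqxx.
    have -> : #|e| = 2%N by rewrite (cardsD1 x) xe (edges_at ee xe).1.
    rewrite /r divfK ?gt_eqF ?exprn_gt0 // ler_nat.
    have e0 : e != set0 by apply/set0Pn; exists x.
    have := constant_on_rare new_colours f e0; rewrite card_new_colours.
    by apply: leq_trans; apply: subset_leq_card; apply/subsetP=> g; rewrite !inE.
  - move=> u; apply: le_trans budget; rewrite big_sumType /=; apply: lerD.
      apply: (@le_trans _ _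
          (\sum_(e in [set [set u; w] | w in neighbours u]) r / b)).
        rewrite big_mkcond [leRHS]big_mkcond /=; apply: ler_sum => e _.
        case: ifPn => ue; last by case: ifP => // _; rewrite divr_ge0 // ltW.
        case: ifPn => ee; first by have [-> ->] := edges_at ee ue; rewrite expr1.
        by rewrite mul0r; case: ifP => // _; rewrite divr_ge0 // ltW.
      rewrite sumr_const [leRHS]mulr_natl ler_wpMn2l ?divr_ge0 ?(ltW b0) //.
      by rewrite (leq_trans (leq_imset_card _ _)) //; case/andP: (degG u).
    apply: (@le_trans _ _ (\sum_(v in neighbours u) s / b ^+ delta)).
      rewrite (eq_bigl (mem (neighbours u))); last first.
        by move=> v; rewrite !inE sedge_sym.
      apply: ler_sum => v _; rewrite ler_wpM2l // lef_pV2 ?posrE ?exprn_gt0 //.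
      by rewrite ler_wiXn2l ?(ltW b0) // -(cA v) subset_leq_card ?subD1set.
    rewrite sumr_const [leRHS]mulr_natl ler_wpMn2l ?divr_ge0 ?exprn_ge0 ?(ltW b0) //.
    by case/andP: (degG u).
apply: (odd_colourable_of_flawless (f := f)) => // [u v uv|v].
  have := f_ok (inl [set u; v]); rewrite /= negb_and => /orP[|//].
  by case/negP; apply/existsP; exists u; apply/existsP; exists v; rewrite uv eqxx.
exact: f_ok (inr v).
Qed.

End Palette.

End Graph.

(** * The choice of the parameters *)

(** The slope comes from [expR y >= (1 + y / 4) ^+ 4]; the value 0.78
    is what [failure_budget] requires, namely 0.28 to pay for [b ^- delta] and
    0.5 to leave [expR (- 2 * L)]. *)
Lemma expR_chord (R : realType) (y : R) : 0 <= y <= 2 / 5 -> expR (- y) <= 1 - 39 / 50 * y.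
Proof.
move=> /andP[y0 y1].
have [t [-> t0 t1]] : exists t : R, [/\ y = 4 * t, 0 <= t & t <= 1 / 10].
  by exists (y / 4); split; lra.
rewrite expRN -[leLHS]mulr1 ler_pdivrMl ?expR_gt0 // -[4]/(4%:R) expRM_natl.
apply: (@le_trans _ _ ((1 + t) ^+ 4 * (1 - 39 / 50 * (4 * t)))); first by nra.
apply: ler_wpM2r; first lra.
by apply: lerXn2r; rewrite ?nnegrE ?expR_ge0 ?expR_ge1Dx //; lra.
Qed.

(** Write [P / b ^+ delta] for the second fraction.  Then [P] is at most
    [expR (- 0.78 * p * delta)] and [b ^- delta] at most
    [expR (0.28 * p * delta)], so that the quotient is at most
    [expR (- 2 * L)] because [4 * L <= p * delta].  The edges take 0.22 of the
    0.25 times [p] that [1 - b] allows, and the vertices take the rest since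
    [1 / (4 * Delta)] is at most [0.03 * p]. *)
Lemma failure_budget (R : realType) (Delta delta K : nat) (L p b : R) :
  expR L = 2 * Delta%:R ->
  K%:R = p * (5 * Delta%:R) ->
  b = 1 - p / 4 ->
  delta%:R <= Delta%:R :> R ->
  3 <= L ->
  12 * L <= delta%:R ->
  20 * Delta%:R * L / delta%:R < K%:R ->
  K%:R <= 20 * Delta%:R * L / delta%:R + 1 ->
  [/\ (0 < K)%N, (K <= 5 * Delta - K)%N, 0 < b, b <= 1 &
  Delta%:R * (K%:R / (5 * Delta)%:R ^+ 2 / b) +
  Delta%:R * (((1 + expR (- (2 * delta%:R / (5 * Delta)%:R))) / 2) ^+ K
              / b ^+ delta) <= 1 - b].
Proof.
move=> expL pE bE dD L3 L12 K_gt K_le.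
have dd : 36 <= delta%:R :> R by lra.
have y_le : 20 * Delta%:R * L / delta%:R <= 20 / 12 * Delta%:R.
  by rewrite ler_pdivrMr; [nra|lra].
have p35 : p <= 35 / 100 by move: K_le; rewrite pE; nra.
have pd : 4 * L <= p * delta%:R.
  by move: K_gt; rewrite ltr_pdivrMr ?pE; [nra|lra].
have K_pos : 0 < K%:R :> R.
  apply: le_lt_trans K_gt; rewrite divr_ge0 ?mulr_ge0 ?ler0n //; lra.
have D0 : 0 < Delta%:R :> R by lra.
have p0 : 0 < p by move: K_pos; rewrite pE pmulr_lgt0 //; lra.
have b_ge : 365 / 400 <= b by rewrite bE; lra.
have b0 : 0 < b by lra.
split=> //.
- by rewrite -(ltr0n R).
- rewrite leq_subRL.
    rewrite -(ler_nat R) natrD natrM pE; nra.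
  rewrite -(ler_nat R) natrM pE; nra.
- by rewrite bE; lra.
have edge : Delta%:R * (K%:R / (5 * Delta)%:R ^+ 2 / b) <= 22 / 100 * p.
  have -> : Delta%:R * (K%:R / (5 * Delta)%:R ^+ 2 / b) = p / 5 / b.
    by rewrite pE natrM; field; rewrite !gt_eqF.
  by rewrite ler_pdivrMr //; nra.
have binv : b^-1 <= expR (28 / 100 * p).
  apply: le_trans (expR_ge1Dx _); rewrite -[leLHS]mulr1 ler_pdivrMl //.
  rewrite bE; nra.
have parity : (1 + expR (- (2 * delta%:R / (5 * Delta)%:R))) / 2 <=
    expR (- (39 / 100 * (2 * delta%:R / (5 * Delta)%:R))) :> R.
  apply: le_trans (expR_ge1Dx _); set y := 2 * _ / _.
  have : expR (- y) <= 1 - 39 / 50 * y; last lra.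
  apply: expR_chord; rewrite /y natrM; apply/andP; split.
    by rewrite divr_ge0 //; lra.
  rewrite ler_pdivrMr; lra.
have vertex : ((1 + expR (- (2 * delta%:R / (5 * Delta)%:R))) / 2) ^+ K
    / b ^+ delta <= (4 * Delta%:R ^+ 2)^-1 :> R.
  apply: (@le_trans _ _ (expR (- (39 / 100 * (2 * delta%:R / (5 * Delta)%:R))) ^+ K *
      expR (28 / 100 * p) ^+ delta)).
    rewrite -exprVn; apply: ler_pM.
    - by rewrite exprn_ge0 // divr_ge0 ?addr_ge0 ?expR_ge0.
    - by rewrite exprn_ge0 // invr_ge0 ltW.
    - by apply: lerXn2r => //; rewrite nnegrE ?expR_ge0 // divr_ge0 ?addr_ge0 ?expR_ge0.
    - by apply: lerXn2r => //; rewrite nnegrE ?expR_ge0 // invr_ge0 ltW.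
  rewrite -!expRM_natl -expRD.
  have -> : (4 * Delta%:R ^+ 2)^-1 = expR (- (2 * L)) :> R.
    rewrite expRN -[2]/(2%:R) expRM_natl expL.
    by congr (_^-1); ring.
  rewrite ler_expR.
  have -> : K%:R * - (39 / 100 * (2 * delta%:R / (5 * Delta)%:R)) =
     - (78 / 100 * (p * delta%:R)) :> R.
    by rewrite pE natrM; field; rewrite gt_eqF.
  rewrite mulrCA; lra.
have -> : 1 - b = 22 / 100 * p + 3 / 100 * p by rewrite bE; lra.
apply: lerD edge _.
apply: (@le_trans _ _ (Delta%:R * (4 * Delta%:R ^+ 2)^-1)).
  by rewrite ler_wpM2l // ltW.
have -> : Delta%:R * (4 * Delta%:R ^+ 2)^-1 = (4 * Delta%:R)^-1 :> R.
  by field; rewrite gt_eqF.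
rewrite -[leLHS]mulr1 ler_pdivrMl; last lra.
nra.
Qed.

(** The last two conclusions serve the asymptotic form of the bound: they absorb
    the summand 1 and the factor 2 inside the logarithm. *)
Lemma odd_chromatic_bound (R : realType) (G : sgraph) (Delta delta : nat) :
  max_degree G = Delta -> min_degree G = delta ->
  3 <= ln (Delta%:R : R) -> 12 * ln (2 * Delta%:R : R) <= delta%:R ->
  [/\ (odd_chromatic_number G)%:R <= (chromatic_number G)%:R +
    (20 * Delta%:R * ln (2 * Delta%:R) / delta%:R + 1) :> R,
   (0 < delta <= Delta)%N & ln (2 * Delta%:R : R) <= 2 * ln Delta%:R].
Proof.
move=> maxG minG lnD3 L12.
have D0 : 0 < Delta%:R :> R.
  by rewrite ltr0n lt0n; apply/eqP => D0; move: lnD3; rewrite D0 ln0 //; lra.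
have lnM2 : ln (2 * Delta%:R : R) = ln 2 + ln Delta%:R by rewrite lnM ?posrE.
have ln2_ge0 : 0 <= ln 2 :> R by rewrite ln_ge0 // ler1n.
have ln2_le1 : ln 2 <= 1 :> R.
  by rewrite -[leRHS]expRK ler_ln ?posrE ?expR_gt0 //; exact: expR_ge1Dx.
have d0 : (0 < delta)%N by rewrite -(ltr0n R); lra.
have [v _] : exists v : G, v \in G.
  apply/card_gt0P; rewrite lt0n; apply/negP => /eqP/card0_eq G0.
  by move: D0; rewrite -maxG /max_degree big_pred0 ?ltxx //.
have dD : (delta <= Delta)%N.
  by rewrite -maxG -minG (leq_trans (min_degree_le v)) ?degree_le_max.
split; [|by rewrite d0|lra].
set y := _ / _.
have y0 : 0 <= y by rewrite divr_ge0 ?mulr_ge0 ?ler0n //; lra.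
pose K := (Num.truncn y).+1.
have /andP[yK Ky] := truncn_itv y0.
have K_le : K%:R <= y + 1 by rewrite /K -natr1 lerD2r.
pose p : R := K%:R / (5 * Delta%:R).
have pE : K%:R = p * (5 * Delta%:R) by rewrite divfK // gt_eqF // mulr_gt0.
have expL : expR (ln (2 * Delta%:R)) = 2 * Delta%:R :> R.
  by rewrite lnK // posrE mulr_gt0.
have [||K0 KM b0 b1 budget] :=
    failure_budget expL pE (erefl (1 - p / 4)) _ _ L12 Ky K_le.
- by rewrite ler_nat.
- lra.
have Gk : colourable G (chromatic_number G).
  by rewrite /chromatic_number; case: ex_minnP.
have : odd_colourable G (chromatic_number G + K).
  have KN : (K + (5 * Delta - K) = 5 * Delta)%N.
    by rewrite subnKC // (leq_trans KM) // leq_subr.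
  apply: (random_new_colours (M := 5 * Delta - K) (Delta := Delta) Gk d0 _ b0 b1).
  - by rewrite K0.
  - by move=> u; rewrite -maxG -minG min_degree_le degree_le_max.
  - by rewrite KN.
rewrite /odd_chromatic_number; case: ex_minnP => m _ m_min /m_min.
rewrite -(ler_nat R) natrD => /le_trans; apply; rewrite lerD2l //.
Qed.

Theorem corollary5p4 (R : realType) :
  (exists Delta0 : nat,
    forall (G : sgraph) (Delta delta : nat),
      max_degree G = Delta -> min_degree G = delta ->
      (Delta0 <= Delta)%N ->
      12 * ln (2 * Delta%:R : R) <= delta%:R ->
      (odd_chromatic_number G)%:R <=
        (chromatic_number G)%:R
        + (Num.ceil (4 * (ln (Delta%:R : R) + ln (ln (Delta%:R : R)) + 3)))%:~R
        + 20 * Delta%:R * ln (2 * Delta%:R) / delta%:R :> R)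
  /\
  (exists (C : R) (Delta1 : nat),
    forall (G : sgraph) (Delta delta : nat),
      max_degree G = Delta -> min_degree G = delta ->
      (Delta1 <= Delta)%N ->
      12 * ln (2 * Delta%:R : R) <= delta%:R ->
      (odd_chromatic_number G)%:R <=
        (chromatic_number G)%:R + C * (Delta%:R * ln Delta%:R / delta%:R)).
Proof.
pose Delta0 := (Num.truncn (expR 3 : R)).+1.
have ln_large (Delta : nat) : (Delta0 <= Delta)%N -> 3 <= ln (Delta%:R : R).
  move=> leD; have h : expR 3 <= Delta%:R :> R.
    by apply/ltW/(lt_le_trans (truncnS_gt _)); rewrite ler_nat.
  by rewrite -[leLHS]expRK ler_ln ?posrE ?expR_gt0 // (lt_le_trans _ h) ?expR_gt0.
split.
  exists Delta0 => G Delta delta maxG minG /ln_large lnD L12.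
  have [bound _ _] := odd_chromatic_bound maxG minG lnD L12.
  apply: le_trans bound _; rewrite -[leRHS]addrA lerD2l [leRHS]addrC lerD2l.
  have lnln : 0 <= ln (ln (Delta%:R : R)) by rewrite ln_ge0 //; lra.
  apply: le_trans (ceil_ge _); lra.
(* 20 ln (2 Delta) <= 40 ln Delta, and 1 <= Delta ln Delta / delta. *)
exists 41, Delta0 => G Delta delta maxG minG /ln_large lnD L12.
have [bound /andP[d0 dD] lnM2] := odd_chromatic_bound maxG minG lnD L12.
apply: le_trans bound _; rewrite lerD2l.
have d0R : 0 < delta%:R :> R by rewrite ltr0n.
have dDR : delta%:R <= Delta%:R :> R by rewrite ler_nat.
rewrite mulrA -[X in _ + X](@divff _ delta%:R) ?gt_eqF // -mulrDl.
rewrite ler_pM2r ?invr_gt0 //; nra.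
Qed.
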